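(* Let $F$ be a number field. If the function $h^0$ on $\mathrm{Pic}^{(0)}(F)$ assumes its maximum in the origin $[O_F]$, then for every Arakelov divisor $D$ of $F$ with $\deg(D)\ge 0$ we have $$h^0(D)\le\deg(D)+h^0(O_F).$$
   Context: Let $F$ be a number field with ring of integers $O_F$. The infinite primes $\sigma$ of $F$ are the real embeddings together with one chosen embedding from each pair of complex conjugate embeddings. An Arakelov divisor of $F$ is a formal finite sum $D=\sum_P x_P P+\sum_\sigma x_\sigma\sigma$, with $P$ running over the nonzero prime ideals of $O_F$, $\sigma$ over the infinite primes, $x_P\in\mathbb{Z}$ (almost all zero) and $x_\sigma\in\mathbb{R}$. The degree is $\deg(D)=\sum_P \log(\#(O_F/P))\,x_P+\sum_\sigma x_\sigma$. For $f\in F^*$ the principal Arakelov divisor $(f)$ has $x_P=\mathrm{ord}_P(f)$, $x_\sigma=-\log|\sigma(f)|$ for $\sigma$ real and $x_\sigma=-2\log|\sigma(f)|$ for $\sigma$ complex; it has degree $0$. $\mathrm{Pic}(F)$ is the group of Arakelov divisors modulo principal ones and $\mathrm{Pic}^{(0)}(F)$ is its subgroup of classes of degree $0$. The fractional ideal associated to $D$ is $I=\prod_P P^{-x_P}$. For $f\in F$ put $$\|f\|_D^2=\sum_{\sigma\text{ real}}|\sigma(f)|^2e^{-2x_\sigma}+\sum_{\sigma\text{ complex}}2|\sigma(f)|^2e^{-x_\sigma}.$$ Put $h^0(D)=\log\left(\sum_{f\in I}e^{-\pi\|f\|_D^2}\right)$; this depends only on the class of $D$ in $\mathrm{Pic}(F)$,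 so $h^0$ is a function on $\mathrm{Pic}(F)$. The symbol $O_F$, used as an Arakelov divisor, denotes the trivial divisor (all coefficients zero, with associated ideal $O_F$), and $[O_F]$ is its class, the neutral element of $\mathrm{Pic}(F)$. *)

(* Defs.v *)
From HB Require Import structures.
From mathcomp Require Import all_boot all_order all_algebra all_field.
From mathcomp Require Import ring_quotient finmap.
From mathcomp Require Import all_classical all_reals all_analysis.
From mathcomp Require Import complex.
Set Implicit Arguments.
Unset Strict Implicit.
Unset Printing Implicit Defensive.
Import Order.TTheory GRing.Theory Num.Theory.
Local Open Scope classical_set_scope.
Local Open Scope fset_scope.
Local Open Scope ring_scope.

(** A number field is a [fieldExtType rat]: a field of finite degree over Q. *)

Section RingOfIntegers.
Variable F : fieldExtType rat.

Definition algint : {pred F} :=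
  fun x => `[< integralOver (intr : int -> F) x >].

Fact algint_subring_closed : subring_closed algint.
Proof.
split; first by apply/asboolP; exact: integral1.
- by move=> x y /asboolP ix /asboolP iy; apply/asboolP; exact: integral_sub.
- by move=> x y /asboolP ix /asboolP iy; apply/asboolP; exact: integral_mul.
Qed.
HB.instance Definition _ :=
  GRing.isSubringClosed.Build F algint algint_subring_closed.

Record ring_of_integers := AlgInt {
  algint_val :> F;
  algint_valP : algint_val \in algint
}.
HB.instance Definition _ := [isSub for algint_val].
HB.instance Definition _ := [Choice of ring_of_integers by <:].
HB.instance Definition _ :=
  [SubChoice_isSubComNzRing of ring_of_integers by <:].

End RingOfIntegers.

Section Primes.
Variable F : fieldExtType rat.
Local Notation OF := (ring_of_integers F).

Record nzprime := NzPrime {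
  nzprime_pred :> OF -> bool;
  nzprime_idealr : idealr_closed nzprime_pred;
  nzprime_prime : prime_idealr_closed nzprime_pred;
  nzprime_neq0 : exists2 a : OF, a \in nzprime_pred & a != 0
}.
HB.instance Definition _ := gen_eqMixin nzprime.
HB.instance Definition _ := gen_choiceMixin nzprime.
HB.instance Definition _ (P : nzprime) :=
  isIdealr.Build OF (nzprime_pred P) (nzprime_idealr P).
HB.instance Definition _ (P : nzprime) :=
  isPrimeIdealrClosed.Build OF (nzprime_pred P) (nzprime_prime (n := P)).

(** A prime ideal has exactly one representative in [nzprime], so that sums and
    products indexed by [nzprime] count every prime once. *)
Lemma nzprime_inj : injective nzprime_pred.
Proof.
case=> [p ip pp np] [q iq pq nq] /= epq.
case: _ / epq iq pq nq => iq pq nq; congr NzPrime; exact: Prop_irrelevance.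
Qed.

(** The norm [#(OF / P)]; the residue ring is finite. *)
Definition prime_norm (P : nzprime) : nat :=
  #|` fset_set [set: Quotient.quot (nzprime_pred P : prime_idealr OF)]|.

(** Fractional ideals, as subsets of [F]. *)
Definition OF_frac : set F := range (@algint_val F).

Definition prime_frac (P : nzprime) : set F :=
  [set algint_val a | a in [set a : OF | a \in nzprime_pred P]].

Definition mul_frac (A B : set F) : set F :=
  [set x | exists s : seq (F * F),
    (forall p, p \in s -> A p.1 /\ B p.2) /\ x = \sum_(p <- s) p.1 * p.2].

Definition inv_frac (A : set F) : set F :=
  [set x | forall a, A a -> OF_frac (x * a)].

Definition exp_frac (A : set F) (n : int) : set F :=
  match n with
  | Posz k => iter k (mul_frac A) OF_frac
  | Negz k => iter k.+1 (mul_frac (inv_frac A)) OF_frac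
  end.

(** [P ^ k] is the exact power of [P] containing [a]; in particular [a != 0]. *)
Definition exact_power (P : nzprime) (a : F) (k : nat) : Prop :=
  exp_frac (prime_frac P) k a /\ ~ exp_frac (prime_frac P) k.+1 a.

(** For [f != 0] exactly one [n] qualifies; [ord P 0] is a dummy value. *)
Definition val_spec (P : nzprime) (f : F) : set int :=
  [set n | exists a b : OF, exists k l : nat,
    [/\ f = algint_val a / algint_val b,
        exact_power P (algint_val a) k, exact_power P (algint_val b) l
      & n = k%:Z - l%:Z]].

Definition ord (P : nzprime) (f : F) : int := xget 0 (val_spec P f).

End Primes.

(** The infinite primes, with the choice they involve: a system of
    representatives, up to complex conjugation, of all embeddings of [F] in the
    complex numbers [R[i]]. *)
Record infinite_primes (R : realType) (F : fieldExtType rat) := InfinitePrimes {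
  infp :> finType;
  infp_emb : infp -> {rmorphism F -> R[i]};
  infp_surj : forall tau : {rmorphism F -> R[i]}, exists s,
    tau =1 infp_emb s \/ tau =1 (fun x => conjc (infp_emb s x));
  infp_inj : forall s t,
    infp_emb s =1 infp_emb t \/ infp_emb s =1 (fun x => conjc (infp_emb t x)) ->
    s = t
}.

Section ArakelovDivisors.
Variables (R : realType) (F : fieldExtType rat) (S : infinite_primes R F).
Local Notation OF := (ring_of_integers F).

Definition is_real (s : S) : bool := `[< forall x, complex.Im (infp_emb s x) = 0 >].

Definition absv (s : S) (f : F) : R := Normc.normc (infp_emb s f).

Record arakelov_divisor := ArakelovDivisor {
  fin_coef : {fsfun nzprime F -> int with 0};
  inf_coef : {ffun S -> R}
}.

Definition trivial_divisor : arakelov_divisor :=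
  ArakelovDivisor [fsfun] [ffun=> 0].

Definition deg (D : arakelov_divisor) : R :=
  \sum_(P <- finsupp (fin_coef D)) ln (prime_norm P)%:R * (fin_coef D P)%:~R
  + \sum_(s : S) inf_coef D s.

(** Coefficients of the principal divisor of [f != 0]. *)
Definition principal_fin (f : F) (P : nzprime F) : int := ord P f.
Definition principal_inf (f : F) (s : S) : R :=
  if is_real s then - ln (absv s f) else - 2 * ln (absv s f).

(** The class of [D], i.e. the set of all divisors [D + (f)] with [f != 0]. *)
Definition pic_class (D : arakelov_divisor) : set arakelov_divisor :=
  [set D' | exists f : F, [/\ f != 0,
    forall P, fin_coef D' P = fin_coef D P + principal_fin f P
    & forall s, inf_coef D' s = inf_coef D s + principal_inf f s]].

Definition Pic : set (set arakelov_divisor) := range pic_class.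

(** The degree is constant on a class. *)
Definition Pic0 : set (set arakelov_divisor) :=
  [set c | Pic c /\ exists2 D, c D & deg D = 0].

Definition assoc_ideal (D : arakelov_divisor) : set F :=
  \big[@mul_frac F / @OF_frac F]_(P <- finsupp (fin_coef D))
    exp_frac (prime_frac P) (- fin_coef D P).

Definition normsq (D : arakelov_divisor) (f : F) : R :=
  \sum_(s : S | is_real s) absv s f ^+ 2 * expR (- 2 * inf_coef D s)
  + \sum_(s : S | ~~ is_real s) 2 * absv s f ^+ 2 * expR (- inf_coef D s).

(** The sum converges, so that [fine] only casts it to a real number. *)
Definition h0 (D : arakelov_divisor) : R :=
  ln (fine (\esum_(f in assoc_ideal D) (expR (- pi * normsq D f))%:E)).

(** [h0] depends only on the class of a divisor; its value at a class [c] is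
    [h0 D] for any [D] in [c]. *)
Definition h0_max_at_origin : Prop :=
  forall c, Pic0 c -> forall D, c D -> h0 D <= h0 trivial_divisor.

End ArakelovDivisors.

(* Main.v *)
Require Import Defs.
From mathcomp Require Import all_boot all_order all_algebra all_field all_reals.
From mathcomp Require Import finmap all_classical all_analysis complex.
From mathcomp Require Import measurable_realfun ring lra zify.
Set Implicit Arguments.
Unset Strict Implicit.
Unset Printing Implicit Defensive.
Import Order.TTheory GRing.Theory Num.Theory.
Local Open Scope classical_set_scope.
Local Open Scope ring_scope.

(** Subtracting [deg D] from the coefficient of one infinite prime of [D] gives a
    divisor [D'] of degree 0, so it is enough that
    [theta D <= exp (deg D) * theta D'], where [theta] is the sum whose logarithm
    is [h0]. Passing from [D'] to [D] multiplies some coordinates of the lattice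
    by factors [r_i <= 1] with product [exp (- deg D)].

    For every subgroup [L] of a Euclidean space the periodized Gaussian
    [f w = sum_(x in L) exp (- |x + w|^2)] is maximal at [w = 0]. This needs no
    Poisson summation: rotating pairs by [(x, x') |-> (x + x', x - x')] and
    Cauchy-Schwarz over the classes modulo [2 L] give
    [f w ^ 4 <= f (2 w) * f 0 ^ 3], and iterating contradicts the subquadratic
    growth of [ln f] if [f w > f 0]. Averaging [f w <= f 0] over a normal
    distribution of [w] with independent coordinates yields
    [prod_i r_i * sum_(x in L) exp (- sum_i (r_i x_i)^2) <= f 0]. *)

(** * Sums of nonnegative families *)

Section EsumComplements.
Local Open Scope ereal_scope.
Context {R : realType} {T : choiceType}.
Implicit Types (D : set T) (a : T -> \bar R).

Lemma esum_ge_term D a x : (forall y, D y -> 0 <= a y) -> D x ->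
  a x <= \esum_(y in D) a y.
Proof.
move=> a0 Dx; apply: esum_ge; exists [set x]; last by rewrite fsbig_set1.
by split; [exact: finite_set1|move=> _ ->].
Qed.

Lemma sub_esum D D' a : D `<=` D' -> \esum_(x in D) a x <= \esum_(x in D') a x.
Proof.
move=> DD'; apply: ereal_sup_le => _ [X [finX XD] <-].
by exists X => //; split=> //; exact: subset_trans DD'.
Qed.

Lemma le_esum_seq D a M :
    (forall s : seq T, uniq s -> (forall x, x \in s -> D x) ->
      \sum_(x <- s) a x <= M) ->
  \esum_(x in D) a x <= M.
Proof.
move=> aM; apply: ge_ereal_sup => _ [X [finX XD] <-].
rewrite fsbig_finite//=; apply: aM; first exact: fset_uniq.
by move=> x; rewrite in_fset_set// inE => /XD.
Qed.

Lemma sum_le_esum D a (s : seq T) : (forall x, D x -> 0 <= a x) ->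
  uniq s -> (forall x, x \in s -> D x) ->
  \sum_(x <- s) a x <= \esum_(x in D) a x.
Proof.
move=> a0 us sD; apply: esum_ge; exists [set` s].
  by split; [exact: finite_seq|].
by rewrite fsbig_seq.
Qed.

Lemma esumZl D a c : 0 <= c -> (forall x, D x -> 0 <= a x) ->
  \esum_(x in D) c * a x = c * \esum_(x in D) a x.
Proof.
move=> + a0; case: c => [c|_|//].
(* For finite [c > 0], the same inequality applied to [c * a] with the factor [c^-1] gives the
   converse. *)
- have le_scale (b : T -> \bar R) (k : R) : (0 <= k)%R -> (forall x, D x -> 0 <= b x) ->
      \esum_(x in D) k%:E * b x <= k%:E * \esum_(x in D) b x.
    move=> k0 b0; apply: le_esum_seq => s us sD.
    rewrite big_seq -ge0_sume_distrr; last by move=> x /sD /b0.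
    by rewrite -big_seq lee_wpmul2l// sum_le_esum.
  rewrite lee_fin le_eqVlt => /predU1P[<-|c0].
    by rewrite mul0e esum1// => x _; rewrite mul0e.
  apply/eqP; rewrite eq_le le_scale ?(ltW c0)//=.
  have ca0 x : D x -> 0 <= c%:E * a x.
    by move=> Dx; apply: mule_ge0 (a0 x Dx); rewrite lee_fin ltW.
  have := le_scale (fun x => c%:E * a x) c^-1%R; rewrite invr_ge0 ltW//.
  move=> /(_ isT ca0) /(lee_wpmul2l (ltW c0 : 0 <= c%:E)).
  rewrite muleA -EFinM divff ?gt_eqF// mul1e; apply: le_trans.
  rewrite le_eqVlt; apply/orP; left; apply/eqP; congr (_ * _).
  by apply: eq_esum => x Dx; rewrite muleA -EFinM mulVf ?gt_eqF// mul1e.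
- have [Dz|/existsNP[x /not_implyP[Dx /eqP ax]]] :=
    pselect (forall x, D x -> a x = 0).
    by rewrite !esum1 ?mule0// => x /Dz ->; rewrite mule0.
  have ax0 : 0 < a x by rewrite lt0e ax a0.
  have ge0 y : D y -> 0 <= +oo * a y by move=> Dy; exact: mule_ge0 (a0 y Dy).
  rewrite [RHS]gt0_mulye ?(lt_le_trans ax0 (esum_ge_term a0 Dx))//.
  by have := esum_ge_term ge0 Dx; rewrite gt0_mulye// leye_eq => /eqP.
Qed.

End EsumComplements.

Lemma mul_esum {R : realType} {T1 T2 : choiceType} (D1 : set T1) (D2 : set T2)
    (a : T1 -> \bar R) (b : T2 -> \bar R) :
    (forall x, D1 x -> 0 <= a x)%E -> (forall y, D2 y -> 0 <= b y)%E ->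
  ((\esum_(x in D1) a x) * (\esum_(y in D2) b y) =
   \esum_(k in D1 `*` D2) a k.1 * b k.2)%E.
Proof.
move=> a0 b0; rewrite muleC -esumZl//; last exact: esum_ge0.
under eq_esum => x D1x do rewrite muleC -esumZl ?a0//.
rewrite (esum_esum (J := fun=> D2)) => [|x y /a0 ? /b0 ?]; last exact: mule_ge0.
by [].
Qed.

(** Termwise [g h <= (l / 2) g^2 + (1 / (2 l)) h^2] for every [l > 0], also for infinite values.
    Summing gives finiteness, and a suitable [l] gives the square. *)
Lemma esum_CauchySchwarz {R : realType} {T : choiceType} (D : set T)
    (g h : T -> \bar R) (A B : R) : 0 < A -> 0 < B ->
    (forall x, D x -> (0 <= g x)%E) -> (forall x, D x -> (0 <= h x)%E) ->
    (\esum_(x in D) g x * g x = A%:E)%E -> (\esum_(x in D) h x * h x = B%:E)%E ->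
  (\esum_(x in D) g x * h x < +oo)%E /\
  fine (\esum_(x in D) g x * h x)%E ^+ 2 <= A * B.
Proof.
move=> A0 B0 g0 h0 eA eB.
have bound l : 0 < l ->
    (\esum_(x in D) g x * h x <= (l / 2 * A + l^-1 / 2 * B)%:E)%E.
  move=> l0; have li0 : 0 < l^-1 by rewrite invr_gt0.
  have pos1 : 0 < l / 2 by rewrite divr_gt0.
  have pos2 : 0 < l^-1 / 2 by rewrite divr_gt0.
  have p1 : (0 <= (l / 2)%:E)%E by rewrite lee_fin ltW.
  have p2 : (0 <= (l^-1 / 2)%:E)%E by rewrite lee_fin ltW.
  have gg x : D x -> (0 <= g x * g x)%E by move=> /g0 ?; exact: mule_ge0.
  have hh x : D x -> (0 <= h x * h x)%E by move=> /h0 ?; exact: mule_ge0.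
  rewrite EFinD !EFinM -eA -eB -(esumZl p1 gg) -(esumZl p2 hh).
  rewrite -esumD => [|x /gg ?|x /hh ?]; [|exact: mule_ge0|exact: mule_ge0].
  apply: le_esum => x Dx; move: (g0 x Dx) (h0 x Dx).
  case: (g x) (h x) => [u||//] [v||//] u0 v0.
  - rewrite -!EFinM lee_fin -subr_ge0.
    have -> : l / 2 * (u * u) + l^-1 / 2 * (v * v) - u * v =
        l / 2 * (u - l^-1 * v) ^+ 2 by field; rewrite gt_eqF.
    by rewrite mulr_ge0 ?sqr_ge0 ?ltW.
  - by rewrite mulyy [X in (_ + X)%E]gt0_muley ?lte_fin// addey ?leey.
  - by rewrite mulyy [X in (X + _)%E]gt0_muley ?lte_fin// addye ?leey.
  - by rewrite mulyy !gt0_muley ?lte_fin// leey.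
have : (0 <= \esum_(x in D) g x * h x)%E.
  by apply: esum_ge0 => x Dx; rewrite mule_ge0 ?g0 ?h0.
case: (\esum_(x in D) g x * h x)%E bound => [f||//] bound f0; last first.
  by have := bound 1 ltr01; rewrite leye_eq.
rewrite ltry; split=> //=.
move: f0; rewrite lee_fin le_eqVlt => /predU1P[<-|f0].
  by rewrite expr0n/= mulr_ge0 ?ltW.
(* With [f] the sum to be bounded, the weight [l = f / A] turns the bound into
   [f <= f / 2 + A B / (2 f)]. *)
have := bound (f / A); rewrite divr_gt0// => /(_ isT); rewrite lee_fin.
have -> : f / A / 2 * A + (f / A)^-1 / 2 * B = f / 2 + A * B / f / 2.
  by field; rewrite !gt_eqF.
move=> h1; have {h1} : f <= A * B / f by lra.
by rewrite ler_pdivlMr// -expr2.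
Qed.

(** * Theta series of subgroups of a Euclidean space *)

Definition subgroup {V : zmodType} (L : set V) : Prop :=
  L 0 /\ forall x y, L x -> L y -> L (x - y).

Section Subgroup.
Context {V : zmodType} {L : set V}.
Hypothesis sgL : subgroup L.

Lemma subgroup0 : L 0. Proof. by case: sgL. Qed.

Lemma subgroupB x y : L x -> L y -> L (x - y). Proof. by case: sgL => _; apply. Qed.

Lemma subgroupN x : L x -> L (- x).
Proof. by move=> Lx; rewrite -sub0r; exact: subgroupB subgroup0 Lx. Qed.

Lemma subgroupD x y : L x -> L y -> L (x + y).
Proof. by move=> Lx Ly; rewrite -[y]opprK; exact: subgroupB Lx (subgroupN Ly). Qed.

Lemma subgroupMn x n : L x -> L (x *+ n).
Proof.
move=> Lx; elim: n => [|n IHn]; first by rewrite mulr0n; exact: subgroup0.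
by rewrite mulrS; exact: subgroupD.
Qed.

Lemma subgroupMz x (k : int) : L x -> L (x *~ k).
Proof.
case: k => n Lx; first by rewrite -pmulrn; exact: subgroupMn.
by rewrite NegzE mulrNz -pmulrn; apply: subgroupN; exact: subgroupMn.
Qed.

End Subgroup.

(** * Classes of a subgroup modulo its double *)

Section ModTwo.
Context {V : zmodType}.
Variable L : set V.
Hypothesis sgL : subgroup L.

(** A chosen representative modulo [2 L]. The set given to [xget] depends only on the class of [x],
    hence so does the choice. *)
Definition rep2 (x : V) : V :=
  xget 0 [set u | L u /\ exists2 z, L z & x - u = z *+ 2].

Lemma rep2_spec x : L x -> L (rep2 x) /\ exists2 z, L z & x = rep2 x + z *+ 2.
Proof.
move=> Lx; rewrite /rep2; case: xgetP => [u _ [Lu [z Lz e]]|/(_ x)[]].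
  by split=> //; exists z => //; rewrite -e subrKC.
by split=> //; exists 0; [exact: subgroup0|rewrite subrr mul0rn].
Qed.

Lemma rep2_eq x z : L z -> rep2 (x + z *+ 2) = rep2 x.
Proof.
move=> Lz; congr (xget 0 _); apply/seteqP; split=> u [Lu [t Lt e]]; split=> //.
  by exists (t - z); [exact: subgroupB|rewrite mulrnBl -e addrAC addrK].
by exists (t + z); [exact: subgroupD|rewrite mulrnDl -e addrAC].
Qed.

Lemma rep2K x : L x -> rep2 (rep2 x) = rep2 x.
Proof. by case/rep2_spec => _ [z Lz {2}->]; rewrite rep2_eq. Qed.

(* The coordinates [u = c + 2 z], [v = c + 2 w] of a pair of elements of [L] in
   the same class modulo [2 L], read as [u = x + x'] and [v = x - x']. *)
Lemma rotation_bij : (forall z : V, z *+ 2 = 0 -> z = 0) ->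
  set_bij ((rep2 @` L) `*` (L `*` L)) (L `*` L)
    (fun k => (k.1 + k.2.1 + k.2.2, k.2.1 - k.2.2)).
Proof.
move=> tf; split.
- move=> [c [z w]] [/= [x Lx <-] [Lz Lw]]; have [Lc _] := rep2_spec Lx.
  by split=> /=; [do 2 apply: subgroupD => //|exact: subgroupB].
- move=> [c [z w]] [c' [z' w']] /set_mem[/= [x Lx ec] [Lz Lw]].
  move=> /set_mem[/= [x' Lx' ec'] [Lz' Lw']] [e1 e2].
  (* Adding the two coordinates gives [u = c + 2 z], from which [rep2] recovers [c]. *)
  have e : c + z *+ 2 = c' + z' *+ 2.
    have sumE (p q r : V) : p + q + r + (q - r) = p + q *+ 2.
      by rewrite [q - r]addrC addrA addrK mulr2n addrA.
    by have := congr2 +%R e1 e2; rewrite !sumE.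
  have cc' : c = c'.
    have := congr1 rep2 e; rewrite !rep2_eq// -ec -ec'.
    by rewrite rep2K// rep2K.
  have zz' : z = z'.
    move: e; rewrite cc' => /addrI /eqP; rewrite -subr_eq0 -mulrnBl.
    by move=> /eqP /tf /eqP; rewrite subr_eq0 => /eqP.
  by move: e2; rewrite cc' zz' => /addrI /oppr_inj ->.
- move=> [x x'] [/= Lx Lx']; have Ls := subgroupD sgL Lx Lx'.
  have [Lc [z Lz e]] := rep2_spec Ls.
  exists (rep2 (x + x'), (z, z - x')).
    by split=> /=; [exists (x + x')|split=> //; exact: subgroupB].
  rewrite /= subKr; congr (_, _); rewrite addrA -[_ + z + z]addrA -mulr2n -e.
  by rewrite addrK.
Qed.

End ModTwo.

(** * Periodized Gaussians, the rotation identity and the doubling inequality *)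

Definition sqn {R : realType} {I : finType} (v : {ffun I -> R}) : R :=
  \sum_i v i ^+ 2.

Definition theta {R : realType} {I : finType} (a : R) (L : set {ffun I -> R})
    (w : {ffun I -> R}) : \bar R :=
  (\esum_(x in L) (expR (- (a * sqn (x + w))))%:E)%E.
Arguments theta {R I} a%_R L%_classical_set_scope w%_R.

Section Theta.
Context {R : realType} {I : finType}.
Local Notation V := {ffun I -> R}.
Implicit Types (L : set V) (a : R) (v w x y : V).

Lemma sqn_ge0 v : 0 <= sqn v. Proof. by apply: sumr_ge0 => i _; exact: sqr_ge0. Qed.

Lemma ge0_term a v : (0 <= (expR (- (a * sqn v)))%:E)%E.
Proof. by rewrite lee_fin expR_ge0. Qed.
#[local] Hint Resolve ge0_term : core.

Lemma theta_ge0 a L w : (0 <= theta a L w)%E.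
Proof. by apply: esum_ge0. Qed.

Lemma theta_gt0 a L w : L 0 -> (0 < theta a L w)%E.
Proof.
move=> L0; apply: lt_le_trans (esum_ge_term _ L0) => //.
by rewrite lte_fin expR_gt0.
Qed.

Lemma theta_sub a L L' w : L `<=` L' -> (theta a L w <= theta a L' w)%E.
Proof. exact: sub_esum. Qed.

Lemma theta_period a L w : subgroup L -> L w -> theta a L w = theta a L 0.
Proof.
move=> sgL Lw; rewrite [RHS](@reindex_esum _ _ _ L L (fun x => x + w)).
  by apply: eq_esum => x _; rewrite addr0.
split=> [x Lx|x y _ _ /addIr//|x Lx]; first exact: subgroupD.
by exists (x - w); [exact: subgroupB|rewrite subrK].
Qed.

Lemma torsion_free v : v *+ 2 = 0 -> v = 0.
Proof.
move=> v0; apply/ffunP => i; have /ffunP/(_ i) := v0.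
by rewrite ffunMnE !ffunE => /eqP; rewrite mulrn_eq0 => /eqP.
Qed.

(** With [u = x + x'] and [v = x - x'], the parallelogram law gives [a |x + y|^2 + a |x' + y'|^2 =
    (a / 2) (|u + y + y'|^2 + |v + y - y'|^2)]. Writing [u = c + 2 z], [v = c + 2 w] separates the
    sums over [z] and [w] and changes the scale to [2 a]. *)
Lemma theta_mul a L y y' : subgroup L ->
  (theta a L y * theta a L y' =
   \esum_(c in rep2 L @` L)
     theta (2 * a) L (2^-1 *: (c + (y + y'))) *
     theta (2 * a) L (2^-1 *: (c + (y - y'))))%E.
Proof.
move=> sgL; rewrite [LHS]mul_esum//.
rewrite (@reindex_esum _ _ _ _ _ _ _ (rotation_bij sgL torsion_free)).
under [RHS]eq_esum => c _.
  rewrite mul_esum//.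
  over.
rewrite /= (esum_esum (J := fun=> L `*` L)); last first.
  by move=> *; exact: mule_ge0.
apply: eq_esum => -[c [z w]] _ /=; rewrite -!EFinM -!expRD; congr (expR _)%:E.
rewrite -!opprD !mulr_sumr -!big_split; congr (- _); apply: eq_bigr => i _ /=.
by rewrite !ffunE /= !/(_ *: _) /=; field.
Qed.

(** By [theta_mul], the products at [(w, w)], [(2 w, 0)] and [(0, 0)] are the sums over classes of
    [G H], [G G] and [H H], so Cauchy-Schwarz applies. It yields finiteness at [w] as well. *)
Lemma theta_doubling a L w : subgroup L ->
    (theta a L 0 < +oo)%E -> (theta a L (w *+ 2) < +oo)%E ->
  (theta a L w < +oo)%E /\
  fine (theta a L w) ^+ 4 <= fine (theta a L (w *+ 2)) * fine (theta a L 0) ^+ 3.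
Proof.
move=> sgL; have L0 := subgroup0 sgL.
have := theta_mul a w w sgL; have := theta_mul a (w *+ 2) 0 sgL.
have := theta_mul a 0 0 sgL.
rewrite !addr0 !subr0 subrr -mulr2n.
set G := fun c => theta (2 * a) L (2^-1 *: (c + w *+ 2)).
set H := fun c => theta (2 * a) L (2^-1 *: (c + 0)).
move=> eB eA eT.
have G0 c : (0 <= G c)%E by exact: theta_ge0.
have H0 c : (0 <= H c)%E by exact: theta_ge0.
move: (theta_gt0 a 0 L0) (theta_gt0 a (w *+ 2) L0) (theta_gt0 a w L0) eA eB eT.
case: (theta a L 0) => [b||//] b0 d0 f0 eA eB eT //= _.
case: (theta a L (w *+ 2)) d0 eA => [d||//] //= d0 eA _.
rewrite !lte_fin in b0 d0.
have db0 : 0 < d * b by exact: mulr_gt0.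
have bb0 : 0 < b * b by exact: mulr_gt0.
have := esum_CauchySchwarz db0 bb0 (fun c _ => G0 c) (fun c _ => H0 c) (esym eA) (esym eB).
rewrite -eT; clear eA eB eT.
case: (theta a L w) f0 => [f||//] /= f0; last by rewrite mulyy => -[].
move=> [_ h]; split; first exact: ltry.
by rewrite (le_trans _ (le_trans h _))// le_eqVlt; apply/orP; left; apply/eqP; ring.
Qed.

End Theta.

(** * Finitely generated subgroups *)

Section FinitelyGenerated.
Context {V : zmodType}.
Implicit Types (s : seq V) (L : set V).

Fixpoint zspan s : set V :=
  if s is g :: s' then [set x | exists k : int, zspan s' (x - g *~ k)]
  else [set 0].

Lemma zspan_subgroup s : subgroup (zspan s).
Proof.
elim: s => [|g s [IH0 IHB]].
  by split=> [|_ _ -> ->] //=; rewrite subr0.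
split=> [|x y [k xk] [l yl]] /=; first by exists 0; rewrite mulr0z subr0.
exists (k - l); rewrite mulrzBr opprB [g *~ l - _]addrC addrACA [- y + _]addrC.
by rewrite -[g *~ l - y]opprB; exact: IHB.
Qed.

Lemma mem_zspan s x : x \in s -> zspan s x.
Proof.
elim: s => // g s IHs; rewrite inE => /predU1P[->|/IHs xs] /=.
  by exists 1; rewrite mulr1z subrr; exact: subgroup0 (zspan_subgroup s).
by exists 0; rewrite mulr0z subr0.
Qed.

Lemma zspan_min L s : subgroup L -> (forall x, x \in s -> L x) ->
  zspan s `<=` L.
Proof.
move=> sgL; elim: s => [_ _ ->|g s IHs sL x [k xk]]; first exact: subgroup0.
rewrite -[x](subrK (g *~ k)); apply: subgroupD => //.
  by apply: IHs xk => y ys; apply: sL; rewrite inE ys orbT.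
by apply: subgroupMz => //; apply: sL; rewrite inE eqxx.
Qed.

(** Finiteness of [L / 2 L], the form in which finite generation enters [theta_quarter]. The list
    may represent a class several times. *)
Definition finite_mod2 L : Prop := exists cs : seq V,
  (forall c, c \in cs -> L c) /\
  (forall x, L x -> exists2 c, c \in cs & exists2 z, L z & x = c + z *+ 2).

Lemma zspan_finite_mod2 s : finite_mod2 (zspan s).
Proof.
elim: s => [|g s [cs [csL csP]]].
  exists [:: 0]; split=> [c|_ ->]; first by rewrite inE => /eqP ->.
  by exists 0; rewrite ?inE//; exists 0; rewrite ?mul0rn ?addr0.
have sub : zspan s `<=` zspan (g :: s).
  by move=> x xs; exists 0; rewrite mulr0z subr0.
have sgL := zspan_subgroup (g :: s).
have Lg : zspan (g :: s) g by apply: mem_zspan; rewrite inE eqxx.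
exists (cs ++ [seq c + g | c <- cs]); split=> [c|x [k /csP[c ccs [z Lz e]]]].
  rewrite mem_cat => /orP[/csL /sub//|/mapP[c' /csL /sub Lc' ->]].
  exact: subgroupD.
(* The parity of the coefficient of [g] decides between the representatives [c] and [c + g]. *)
have [m [b ek]] : exists (m : int) (b : bool), k = m * 2 + b%:Z.
  by exists (k %/ 2)%Z, (k %% 2 == 1)%Z; lia.
exists (c + g *+ b).
  rewrite mem_cat; case: b {ek} => /=; last by rewrite addr0 ccs.
  by apply/orP; right; apply/mapP; exists c.
exists (z + g *~ m).
  by apply: subgroupD; [|exact: sub|exact: subgroupMz].
rewrite -[x](subrK (g *~ k)) e ek mulrzDr [g *~ _ + _]addrC addrACA.
by rewrite mulrnDl mulrzA -!pmulrn.
Qed.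

End FinitelyGenerated.

(** * Maximality of the periodized Gaussian at the origin *)

Section ShiftedTheta.
Context {R : realType} {I : finType}.
Local Notation V := {ffun I -> R}.
Implicit Types (L : set V) (a : R) (v w x y : V).

(** At scale [a / 4] the coset [c + 2 L] contributes [theta a L (c / 2)]. This is finite by
    [theta_doubling], because doubling [c / 2] gives the period [c]; and there are finitely many
    cosets. *)
Lemma theta_quarter a L : subgroup L -> finite_mod2 L ->
  (theta a L 0 < +oo)%E -> (theta (a / 4) L 0 < +oo)%E.
Proof.
move=> sgL [cs [csL csP]] fin0.
pose C c := (fun z => c + z *+ 2) @` L.
pose e x := (expR (- (a / 4 * sqn (x + 0))))%:E.
have e0 x : (0 <= e x)%E by rewrite lee_fin expR_ge0.
have half c : (\esum_(x in C c) e x = theta a L (2^-1 *: c))%E.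
  rewrite esum_image; last by move=> x y _ _ /addrI/eqP; rewrite -subr_eq0
    -mulrnBl => /eqP/torsion_free/eqP; rewrite subr_eq0 => /eqP.
  apply: eq_esum => z _; congr (expR (- _))%:E; rewrite !mulr_sumr.
  by apply: eq_bigr => i _; rewrite !(ffunMnE, ffunE) /= !/(_ *: _) /=; field.
have le : (theta (a / 4) L 0 <=
    \sum_(c <- cs) \esum_(x in L `&` C c) e x)%E.
  under eq_bigr do rewrite esum_mkcondr.
  rewrite -esum_sum => [|x c _ _]; last by case: ifP.
  apply: le_esum => x /csP[c ccs [z Lz xE]].
  rewrite (big_rem c)//= ifT; last by rewrite inE; exists z.
  by rewrite leeDl// sume_ge0// => ? _; case: ifP.
apply: le_lt_trans le _; rewrite big_seq.
apply: lte_sum_pinfty => c ccs.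
apply: le_lt_trans (sub_esum _ (@subIsetr _ L (C c))) _; rewrite half.
have e2 : (2^-1 *: c) *+ 2 = c by rewrite -scaler_nat scalerA divff// scale1r.
have [|+ _] := @theta_doubling _ _ a L (2^-1 *: c) sgL fin0; last exact.
by rewrite e2 (theta_period a sgL (csL _ ccs)).
Qed.

(** Termwise, [|x + w|^2 - d |x|^2 + d / (1 - d) |w|^2] equals [|(1 - d) x + w|^2 / (1 - d)]. Small
    [d] makes the growth in [w] as slow as desired. *)
Lemma theta_shift_bound d L w : 0 < d -> d < 1 ->
  (theta 1 L w <= (expR (d / (1 - d) * sqn w))%:E * theta d L 0)%E.
Proof.
move=> d0 d1; rewrite -esumZl ?lee_fin ?expR_ge0//.
apply: le_esum => x _; rewrite -EFinM lee_fin -expRD ler_expR addr0 mul1r.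
rewrite lerNl opprB -subr_ge0 !mulr_sumr -!sumrB.
apply: sumr_ge0 => i _; rewrite !ffunE.
have -> : (x i + w i) ^+ 2 - (d * x i ^+ 2 - d / (1 - d) * w i ^+ 2) =
   ((1 - d) * x i + w i) ^+ 2 / (1 - d) by field; rewrite subr_eq0 gt_eqF.
by rewrite divr_ge0 ?sqr_ge0// subr_ge0 ltW.
Qed.

Lemma exists_gt_exp4 (x : R) : exists k, x < 4 ^+ k.
Proof.
exists (Num.truncn x); apply: lt_le_trans (truncnS_gt x) _.
by rewrite -natrX ler_nat ltn_expl.
Qed.

(** Along [2^k w] both the lower bound [4^k r w] and [|2^k w|^2] grow like [4^k], so a positive
    [r w] contradicts the growth bound once [d] is small compared with [r w / |w|^2]. *)
Lemma doubling_le0 (r : V -> R) w :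
    (forall v, 4 * r v <= r (v *+ 2)) ->
    (forall d, 0 < d -> exists K, forall v, r v <= K + d * sqn v) ->
  r w <= 0.
Proof.
move=> dbl growth.
have iter k : 4 ^+ k * r w <= r (w *+ 2 ^ k).
  elim: k => [|k IHk]; first by rewrite mul1r expn0 mulr1n.
  by rewrite exprS -mulrA expnSr mulrnA (le_trans _ (dbl _))// ler_pM2l.
have sqn_iter k : sqn (w *+ 2 ^ k) = 4 ^+ k * sqn w.
  rewrite mulr_sumr; apply: eq_bigr => i _; rewrite ffunMnE.
  have -> : w i *+ 2 ^ k = w i * 2 ^+ k by rewrite -natrX mulr_natr.
  have -> : 4 = 2 ^+ 2 :> R by ring.
  by rewrite exprMn -!exprM mulnC mulrC.
rewrite leNgt; apply/negP => r0.
have s1 : 0 < 2 * (sqn w + 1) by have := sqn_ge0 w; lra.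
(* This [d] keeps [d 4^k |w|^2] below half of [4^k r w]; the summand 1 covers [w = 0]. The next
   choice of [k] makes the other half exceed [K]. *)
have [|K hK] := growth (r w / (2 * (sqn w + 1))); first exact: divr_gt0.
have [k Kk] := exists_gt_exp4 (2 * K / r w).
move: Kk; rewrite ltr_pdivrMr// => Kk.
have := le_trans (iter k) (hK _); rewrite sqn_iter => h.
have p4 : 0 < 4 ^+ k :> R by rewrite exprn_gt0.
have : r w / (2 * (sqn w + 1)) * (4 ^+ k * sqn w) <= 4 ^+ k * r w / 2.
  rewrite -subr_ge0.
  have -> : 4 ^+ k * r w / 2 - r w / (2 * (sqn w + 1)) * (4 ^+ k * sqn w) =
     4 ^+ k * r w / (2 * (sqn w + 1)).
    by field; rewrite gt_eqF//; have := sqn_ge0 w; lra.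
  by apply: divr_ge0 (ltW s1); rewrite mulr_ge0 ?(ltW p4) ?(ltW r0).
lra.
Qed.

Lemma ln_doubling (x y z : R) : 0 < x -> 0 < y -> 0 < z ->
  x ^+ 4 <= y * z ^+ 3 -> 4 * (ln x - ln z) <= ln y - ln z.
Proof.
move=> x0 y0 z0; rewrite -ler_ln ?posrE ?mulr_gt0 ?exprn_gt0//.
rewrite lnM ?posrE ?exprn_gt0// !lnXn// -[ln x *+ 4]mulr_natl -[ln z *+ 3]mulr_natl => h; lra.
Qed.

(* Doubling raises [theta w / theta 0] to at least its fourth power, whereas by
   [theta_shift_bound] this ratio is at most [K exp (d |w|^2)] for every
   [d > 0]; so it cannot exceed 1. *)
Lemma theta_max_fg L w : subgroup L -> finite_mod2 L ->
  (theta 1 L 0 < +oo)%E -> (theta 1 L w <= theta 1 L 0)%E.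
Proof.
move=> sgL L2 fin0; have L0 := subgroup0 sgL.
have finq j : (theta (4^-1 ^+ j) L 0 < +oo)%E.
  elim: j => [|j IHj]; first by rewrite expr0.
  by rewrite exprSr; exact: theta_quarter.
have q01 j : 0 < 4^-1 ^+ j.+1 :> R /\ 4^-1 ^+ j.+1 < 1 :> R.
  by rewrite exprn_gt0 ?invr_gt0//; split=> //; rewrite exprn_ilt1//; lra.
have fin v : (theta 1 L v < +oo)%E.
  have [q0 q1] := q01 0; apply: le_lt_trans (theta_shift_bound L v q0 q1) _.
  by apply: lte_mul_pinfty (finq 1); rewrite ?lee_fin ?expR_ge0.
have [t tE] : exists t : V -> R, forall v, theta 1 L v = (t v)%:E.
  exists (fun v => fine (theta 1 L v)) => v.
  by rewrite fineK// ge0_fin_numE ?fin ?theta_ge0.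
have t_gt0 v : 0 < t v by rewrite -lte_fin -tE theta_gt0.
rewrite !tE lee_fin -ler_ln ?posrE// -subr_le0.
apply: (@doubling_le0 (fun v => ln (t v) - ln (t 0))) => [v|d d0].
  have [_] := theta_doubling sgL fin0 (fin (v *+ 2)).
  by rewrite !tE/=; apply: ln_doubling.
(* Finiteness is known at the scales [4^-j]. The exponent [j.+1] is used below because
   [q = 4^-j <= 1] gives [(q / 4) / (1 - q / 4) <= q < d]. *)
have [j jd] : exists j, 4^-1 ^+ j < d.
  have [j dj] := exists_gt_exp4 d^-1; exists j.
  by rewrite exprVn invf_plt ?posrE ?exprn_gt0.
have [q0 q1] := q01 j.
have [K KE] : exists K, theta (4^-1 ^+ j.+1) L 0 = K%:E.
  exists (fine (theta (4^-1 ^+ j.+1) L 0)).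
  by rewrite fineK// ge0_fin_numE ?finq ?theta_ge0.
have K0 : 0 < K by rewrite -lte_fin -KE theta_gt0.
exists (ln K - ln (t 0)) => v.
have := theta_shift_bound L v q0 q1; rewrite tE KE -EFinM lee_fin.
move=> tv; have h : ln (t v) <=
    4^-1 ^+ j.+1 / (1 - 4^-1 ^+ j.+1) * sqn v + ln K.
  rewrite -[X in _ <= X + _]expRK -lnM ?posrE ?expR_gt0//.
  by rewrite ler_ln ?posrE ?mulr_gt0 ?expR_gt0.
suff : 4^-1 ^+ j.+1 / (1 - 4^-1 ^+ j.+1) * sqn v <= d * sqn v by lra.
rewrite ler_wpM2r ?sqn_ge0//.
rewrite (le_trans _ (ltW jd))// ler_pdivrMr ?subr_gt0//.
move: q0 q1; rewrite exprS; set q := 4^-1 ^+ j => q0 q1.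
have qj1 : q <= 1 by rewrite exprn_ile1//; lra.
nra.
Qed.

(** Each finite partial sum at [w] is at most the series of the group generated by its index set, to
    which [theta_max_fg] applies; at 0 that series is at most the one of [L]. *)
Theorem theta_max L w : subgroup L -> (theta 1 L w <= theta 1 L 0)%E.
Proof.
move=> sgL; have [->|] := eqVneq (theta 1 L 0) +oo%E; first exact: leey.
rewrite -ltey => fin0; apply: le_esum_seq => s us sL.
have sgs := zspan_subgroup s.
have le0 := theta_sub 1 0 (zspan_min sgL sL).
apply: (le_trans _ le0); apply: le_trans (theta_max_fg w sgs (zspan_finite_mod2 s) _).
  apply: sum_le_esum us _ => [x _|x]; last exact: mem_zspan.
  by rewrite lee_fin expR_ge0.
exact: le_lt_trans le0 fin0.
Qed.

End ShiftedTheta.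

(** * Gaussian averaging *)

Section GaussianAveraging.
Context {R : realType}.
Local Notation mu := (@lebesgue_measure R).

(* Completing the square in [y]. *)
Lemma gauss_mul_normal_pdf (r l y : R) : 0 < r -> r < 1 ->
  expR (- (l + y) ^+ 2) * normal_pdf 0 (Num.sqrt ((1 - r ^+ 2) / 2) / r) y =
  r * expR (- (r * l) ^+ 2) *
    normal_pdf (- (1 - r ^+ 2) * l) (Num.sqrt ((1 - r ^+ 2) / 2)) y.
Proof.
move=> r0 r1; set t := Num.sqrt _.
have r2 : 0 < 1 - r ^+ 2 by rewrite subr_gt0 expr_lt1// ltW.
have t0 : 0 < t by rewrite sqrtr_gt0 divr_gt0.
have tE : t ^+ 2 = (1 - r ^+ 2) / 2 by rewrite sqr_sqrtr// ltW// divr_gt0.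
rewrite !normal_pdfE ?gt_eqF ?divr_gt0//.
have peakE : normal_peak (t / r) = r * normal_peak t.
  rewrite /normal_peak -mulr_natr -[in RHS]mulr_natr expr_div_n.
  rewrite -!mulrA [(r ^+ 2)^-1 * _]mulrC !mulrA sqrtrM.
    by rewrite -exprVn sqrtr_sqr ger0_norm ?invr_ge0 ?ltW// invfM invrK mulrC.
  by rewrite !mulr_ge0 ?(ltW t0) ?pi_ge0.
have expE : expR (- (l + y) ^+ 2) * normal_fun 0 (t / r) y =
    expR (- (r * l) ^+ 2) * normal_fun (- (1 - r ^+ 2) * l) t y.
  rewrite /normal_fun -!expRD expr_div_n tE; congr expR; field.
  by rewrite !gt_eqF.
by rewrite peakE mulrCA expE; ring.
Qed.

(** Integrate the hypothesis against the centred normal density in [y] of variance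
    [(1 - r^2) / (2 r^2)]. By [gauss_mul_normal_pdf] each summand becomes a constant times a normal
    density of mass 1. *)
Lemma gauss_average {T : Type} (s : seq T) (c l : T -> R) (r M : R) :
    0 < r <= 1 -> (forall x, 0 <= c x) ->
    (forall y, \sum_(x <- s) c x * expR (- (l x + y) ^+ 2) <= M) ->
  \sum_(x <- s) c x * (r * expR (- (r * l x) ^+ 2)) <= M.
Proof.
(* For [r = 1] the variance degenerates to 0, and the hypothesis at [y = 0] is the claim. *)
move=> /andP[r0]; rewrite le_eqVlt => /predU1P[-> _ /(_ 0)|r1 c0 cM].
  by under eq_bigr do rewrite addr0; under [X in _ -> X <= _]eq_bigr do rewrite !mul1r.
have M0 : 0 <= M.
  apply: le_trans (cM 0); apply: sumr_ge0 => x _.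
  by rewrite mulr_ge0 ?expR_ge0.
set t := Num.sqrt ((1 - r ^+ 2) / 2).
have -> : M = fine (\int[mu]_y (M%:E * (normal_pdf 0 (t / r) y)%:E))%E.
  rewrite ge0_integralZl ?integral_normal_pdf ?mule1//.
  - by apply/measurable_EFinP; exact: measurable_normal_pdf.
  - by move=> y _; rewrite lee_fin normal_pdf_ge0.
rewrite -lee_fin fineK; last first.
  rewrite ge0_integralZl ?integral_normal_pdf ?mule1//.
  - by apply/measurable_EFinP; exact: measurable_normal_pdf.
  - by move=> y _; rewrite lee_fin normal_pdf_ge0.
have meas x : measurable_fun setT (fun y : R =>
    (c x * (r * expR (- (r * l x) ^+ 2)) *
     normal_pdf (- (1 - r ^+ 2) * l x) t y)%:E).
  apply/measurable_EFinP; apply: measurable_funM => //.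
  exact: measurable_normal_pdf.
have k0 x : 0 <= c x * (r * expR (- (r * l x) ^+ 2)).
  by rewrite mulr_ge0 ?c0 ?mulr_ge0 ?(ltW r0) ?expR_ge0.
have -> : (\sum_(x <- s) c x * (r * expR (- (r * l x) ^+ 2)))%:E =
    (\int[mu]_y \sum_(x <- s) (c x * (r * expR (- (r * l x) ^+ 2)) *
     normal_pdf (- (1 - r ^+ 2) * l x) t y)%:E)%E.
  rewrite ge0_integral_sum//; last first.
    by move=> x y _; rewrite lee_fin mulr_ge0 ?normal_pdf_ge0.
  rewrite -sumEFin; apply: eq_bigr => x _.
  under eq_integral do rewrite EFinM.
  rewrite ge0_integralZl ?integral_normal_pdf ?mule1//.
  - by apply/measurable_EFinP; exact: measurable_normal_pdf.
  - by move=> y _; rewrite lee_fin normal_pdf_ge0.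
  - by rewrite lee_fin.
apply: ge0_le_integral => //.
- by move=> y _; apply: sume_ge0 => x _; rewrite lee_fin mulr_ge0 ?normal_pdf_ge0.
- exact: emeasurable_sum.
- apply: measurable_funeM.
  by apply/measurable_EFinP; exact: measurable_normal_pdf.
move=> y _; rewrite sumEFin -EFinM lee_fin.
under eq_bigr do rewrite -mulrA -gauss_mul_normal_pdf// mulrA.
by rewrite -mulr_suml ler_wpM2r ?normal_pdf_ge0.
Qed.

End GaussianAveraging.

(** * Contracting the coordinates one at a time *)

Section Stretching.
Context {R : realType} {I : finType}.
Local Notation V := {ffun I -> R}.

Lemma gauss_average_coords (s : seq V) (r : I -> R) (M : R) :
    (forall i, 0 < r i <= 1) ->
    (forall w, \sum_(x <- s) expR (- sqn (x + w)) <= M) ->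
  \sum_(x <- s) (\prod_i r i) * expR (- \sum_i (r i * x i) ^+ 2) <= M.
Proof.
move=> r01 sM.
(* The factors of a summand after averaging over the coordinates in [e]; the others still carry the
   shift [w]. Induction on [e] keeps the bound uniform in [w]. *)
pose f (e : seq I) (w x : V) (i : I) : R :=
  if i \in e then r i * expR (- (r i * x i) ^+ 2) else expR (- (x i + w i) ^+ 2).
have f0 e w x i : 0 <= f e w x i.
  rewrite /f; case: ifP => _; rewrite ?expR_ge0// mulr_ge0 ?expR_ge0//.
  by have /andP[/ltW] := r01 i.
have fM (e : seq I) w : \sum_(x <- s) \prod_i f e w x i <= M.
  elim: e w => [|i e IHe] w.
    rewrite (le_trans _ (sM w))// ler_sum// => x _.
    rewrite -sumrN expR_sum ler_prod// => i _; rewrite f0 /f/= ffunE.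
    exact: lexx.
  have [ie|nie] := boolP (i \in e).
    rewrite (le_trans _ (IHe w))// ler_sum// => x _.
    rewrite ler_prod// => j _; rewrite f0 /f inE.
    by case: eqVneq => [->|_] /=; rewrite ?ie.
  pose c (x : V) := \prod_(j | j != i) f e w x j.
  have c0 x : 0 <= c x by exact: prodr_ge0.
  have cM y : \sum_(x <- s) c x * expR (- (x i + y) ^+ 2) <= M.
    (* Only the [i]-th coordinate of the shift varies, so [c] stays constant. *)
    rewrite (le_trans _ (IHe [ffun j => if j == i then y else w j]))//.
    rewrite ler_sum// => x _; rewrite [leRHS](bigD1 i)//= mulrC.
    rewrite {1}/f (negPf nie) ffunE eqxx ler_wpM2l ?expR_ge0//.
    rewrite ler_prod// => j ji; rewrite f0 /f ffunE (negPf ji); exact: lexx.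
  rewrite (le_trans _ (gauss_average (r01 i) c0 cM))// ler_sum// => x _.
  rewrite (bigD1 i)//= mulrC [f _ _ _ i]/f inE eqxx/= le_eqVlt; apply/predU1P; left.
  by congr (_ * _); apply: eq_bigr => j ji; rewrite /f inE (negPf ji).
rewrite (le_trans _ (fM (enum I) 0))// ler_sum// => x _.
rewrite -sumrN expR_sum -big_split/= ler_prod// => i _.
have /andP[/ltW ri0 _] := r01 i.
by rewrite /f mem_enum/= lexx mulr_ge0 ?expR_ge0.
Qed.

(** On finite partial sums, [theta_max] supplies the bound uniform in [w] that
    [gauss_average_coords] asks for. *)
Theorem theta_stretch (L : set V) (r : I -> R) :
    subgroup L -> (forall i, 0 < r i <= 1) ->
  ((\prod_i r i)%:E * (\esum_(x in L) (expR (- \sum_i (r i * x i) ^+ 2))%:E)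
    <= theta 1 L 0)%E.
Proof.
move=> sgL r01.
have r0 : 0 <= \prod_i r i by apply: prodr_ge0 => i _; have /andP[/ltW] := r01 i.
have [->|] := eqVneq (theta 1 L 0) +oo%E; first exact: leey.
rewrite -ltey => fin0.
rewrite -esumZl ?lee_fin//.
apply: le_esum_seq => s us sL.
rewrite -(@fineK _ (theta 1 L 0)) ?ge0_fin_numE ?theta_ge0//.
under [leLHS]eq_bigr => x _ do rewrite -EFinM.
rewrite sumEFin lee_fin; apply: gauss_average_coords => // w.
rewrite -lee_fin fineK ?ge0_fin_numE ?theta_ge0// -sumEFin.
apply: le_trans (theta_max w sgL).
under eq_bigr do rewrite -[sqn _]mul1r.
by apply: (@sum_le_esum _ _ L) => // x _; rewrite lee_fin expR_ge0.
Qed.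

End Stretching.

(** * Arakelov divisors *)

Section FractionalIdeals.
Variable F : fieldExtType rat.
Implicit Types (A B : set F) (P : nzprime F).

Lemma OF_frac_subgroup : subgroup (@OF_frac F).
Proof.
split=> [|_ _ [a _ <-] [b _ <-]]; first by exists 0 => //; rewrite raddf0.
by exists (a - b) => //; rewrite raddfB.
Qed.

Lemma OF_fracM x y : OF_frac x -> OF_frac y -> @OF_frac F (x * y).
Proof. by move=> [a _ <-] [b _ <-]; exists (a * b) => //; exact: (rmorphM val). Qed.

Lemma mul_frac_subgroup A B : subgroup A -> subgroup (mul_frac A B).
Proof.
move=> sgA; split=> [|_ _ [s [sAB ->]] [t [tAB ->]]].
  by exists [::]; split=> //; rewrite big_nil.
exists (s ++ [seq (- p.1, p.2) | p <- t]); split=> [p|].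
  rewrite mem_cat => /orP[/sAB//|/mapP[q /tAB[Aq Bq] ->]].
  by split=> //; exact: subgroupN.
rewrite big_cat big_map/= -sumrN; congr (_ + _).
by apply: eq_bigr => p _; rewrite mulNr.
Qed.

Lemma prime_frac_subgroup P : subgroup (prime_frac P).
Proof.
split=> [|_ _ [a Pa <-] [b Pb <-]]; first by exists 0; rewrite /= ?rpred0 ?raddf0.
by exists (a - b); rewrite /= ?rpredB ?raddfB.
Qed.

Lemma inv_frac_subgroup A : subgroup (inv_frac A).
Proof.
split=> [a _|x y Ax Ay a Aa]; first by rewrite mul0r; exact: subgroup0 OF_frac_subgroup.
by rewrite mulrBl; apply: (subgroupB OF_frac_subgroup); [exact: Ax|exact: Ay].
Qed.

Lemma exp_frac_subgroup A n : subgroup A -> subgroup (exp_frac A n).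
Proof.
move=> sgA; case: n => [[|k]|k] /=; first exact: OF_frac_subgroup.
  exact: mul_frac_subgroup.
by apply: mul_frac_subgroup; exact: inv_frac_subgroup.
Qed.

Lemma exp_fracZ P k o x : OF_frac o -> exp_frac (prime_frac P) (Posz k) x ->
  exp_frac (prime_frac P) (Posz k) (o * x).
Proof.
move=> [a _ <-]; case: k => [|k] /=.
  by move=> Ox; apply: OF_fracM => //; exists a.
move=> [s [sP ->]]; exists [seq (algint_val a * p.1, p.2) | p <- s].
split=> [p /mapP[q /sP[[b Pb <-] Bq] ->]|].
  split=> //=; exists (a * b); last exact: (rmorphM val).
  by rewrite /= idealMr.
by rewrite big_map mulr_sumr; apply: eq_bigr => p _; rewrite mulrA.
Qed.

Lemma exp_frac_anti P k l : (k <= l)%N ->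
  exp_frac (prime_frac P) (Posz l) `<=` exp_frac (prime_frac P) (Posz k).
Proof.
move=> /subnK <-; elim: (l - k)%N => [//|n IHn] x; rewrite addSn => -[s [sP ->]].
have sgk := exp_frac_subgroup (Posz k) (prime_frac_subgroup P).
rewrite big_seq; elim/big_ind: _ => [|? ? ? ?|p /sP[[a Pa <-] Bp]].
- exact: subgroup0.
- exact: subgroupD.
- by apply: exp_fracZ; [exists a|exact: IHn].
Qed.

(** If [1 = a / b] then [a = b], and since the powers of [P] decrease, the exact power containing an
    element is unique. The default of [xget] is 0 too. This serves to place a divisor in its own
    class. *)
Lemma ord1 P : ord P 1 = 0.
Proof.
rewrite /ord; case: xgetP => // n _ [a [b [k [l [ab [ak ak'] [bl bl'] ->]]]]].
have {}ab : algint_val a = algint_val b.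
  have b0 : algint_val b != 0.
    by apply/eqP => b0; move: ab => /eqP; rewrite b0 invr0 mulr0 oner_eq0.
  by rewrite -[RHS]mul1r ab divfK.
case: (ltngtP k l) => [kl|lk|->]; last by rewrite subrr.
  by case: ak'; rewrite ab; exact: exp_frac_anti bl.
by case: bl'; rewrite -ab; exact: exp_frac_anti ak.
Qed.

End FractionalIdeals.

Lemma big_pair_bool (R : Type) (idx : R) (op : Monoid.com_law idx) (T : finType)
    (G : T * bool -> R) :
  \big[op/idx]_i G i = \big[op/idx]_t op (G (t, true)) (G (t, false)).
Proof.
rewrite (eq_bigr (fun i => G (i.1, i.2))); last by case.
rewrite -(pair_bigA _ (fun t b => G (t, b)))/=.
by apply: eq_bigr => t _; rewrite big_bool.
Qed.

(** * The theta series of a divisor as a lattice sum *)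

Section Divisors.
Variables (R : realType) (F : fieldExtType rat) (S : infinite_primes R F).
Implicit Types (D : arakelov_divisor S).

Definition theta_series D : \bar R :=
  (\esum_(f in assoc_ideal D) (expR (- pi * normsq D f))%:E)%E.

Lemma assoc_ideal_subgroup D : subgroup (assoc_ideal D).
Proof.
rewrite /assoc_ideal; elim/big_ind: _ => [|A B sgA _|P _].
- exact: OF_frac_subgroup.
- exact: mul_frac_subgroup.
- by apply: exp_frac_subgroup; exact: prime_frac_subgroup.
Qed.

Lemma pic_class_refl D : pic_class D D.
Proof.
exists 1; split=> [|P|s]; first exact: oner_neq0.
  by rewrite /principal_fin ord1 addr0.
rewrite /principal_inf; have -> : absv s 1 = 1.
  by rewrite /absv rmorph1 /= expr1n expr0n/= addr0 sqrtr1.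
by rewrite ln1 oppr0 mulr0; case: ifP; rewrite addr0.
Qed.

Lemma normsq0 D : normsq D 0 = 0.
Proof.
have a0 s : absv s 0 = 0 by rewrite /absv rmorph0 /= expr0n/= addr0 sqrtr0.
by rewrite /normsq !big1 ?addr0// => s _; rewrite a0 expr0n/= ?mulr0 mul0r.
Qed.

Lemma theta_series_ge1 D : (1 <= theta_series D)%E.
Proof.
have I0 := subgroup0 (assoc_ideal_subgroup D).
apply: le_trans (esum_ge_term _ I0); last by move=> ? _; rewrite lee_fin expR_ge0.
by rewrite normsq0 mulr0 expR0.
Qed.

Lemma h0E D : h0 D = ln (fine (theta_series D)). Proof. by []. Qed.

(* Junk values: [fine +oo = 0] and [ln 0 = 0]. *)
Lemma h0_infinite D : theta_series D = +oo%E -> h0 D = 0.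
Proof. by rewrite h0E => ->; exact: ln0. Qed.

Lemma h0_ge0 D : 0 <= h0 D.
Proof.
have := theta_series_ge1 D; rewrite h0E.
by case: (theta_series D) => [t||] //= t1; [exact: ln_ge0|rewrite ln0].
Qed.

(* Without infinite primes every summand is 1, and the ideal, being a torsion-free
   group, is trivial or infinite. *)
Lemma h0_le0_empty D : (S -> False) -> h0 D <= 0.
Proof.
move=> S0; have term1 f : (expR (- pi * normsq D f))%:E = 1%E.
  rewrite /normsq !big1 ?addr0 ?mulr0 ?expR0// => s; by case: (S0 s).
have sgI := assoc_ideal_subgroup D.
have [I0|/existsNP[f /not_implyP[If f0]]] :=
    pselect (forall f, assoc_ideal D f -> f = 0).
  have -> : h0 D = 0; last by [].
  rewrite /h0 (_ : assoc_ideal D = [set 0]).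
    by rewrite esum_set1 ?term1//= ln1.
  by apply/seteqP; split=> [f /I0//|_ ->]; exact: subgroup0.
rewrite h0_infinite//.
have ge_n n : (n%:R%:E <= theta_series D)%E.
  have -> : n%:R%:E = (\sum_(x <- [seq (f *+ i)%R | i <- iota 0 n])
      (expR (- pi * normsq D x))%:E)%E.
    under eq_bigr do rewrite term1.
    by rewrite sumEFin big_const_seq count_predT size_map size_iota iter_addr_0.
  apply: sum_le_esum => [x _||x /mapP[i _ ->]]; first by rewrite lee_fin expR_ge0.
    rewrite map_inj_uniq ?iota_uniq// => i j /eqP.
    rewrite -subr_eq0 -!(scaler_nat _ f) -scalerBl scaler_eq0 subr_eq0.
    by move=> /orP[|/eqP//]; rewrite eqr_nat => /eqP.
  exact: subgroupMn.
have := theta_series_ge1 D; case: (theta_series D) ge_n => [t|//|//] ge_n _.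
have := ge_n (Num.truncn t).+1; rewrite lee_fin leNgt.
by rewrite truncnS_gt.
Qed.

Definition coord_scale D (s : S) : R :=
  Num.sqrt (pi * if is_real s then expR (- 2 * inf_coef D s)
                 else 2 * expR (- inf_coef D s)).

(** Scaled so that the squared length is [pi * normsq D]. Every infinite prime gets a real and an
    imaginary ([true]) coordinate; at a real prime the latter is 0. *)
Definition coords D (f : F) : {ffun S * bool -> R} :=
  [ffun i => coord_scale D i.1 *
    (if i.2 then complex.Im (infp_emb i.1 f) else complex.Re (infp_emb i.1 f))].

Lemma coord_scale_sqr D s : coord_scale D s ^+ 2 =
  pi * if is_real s then expR (- 2 * inf_coef D s) else 2 * expR (- inf_coef D s).
Proof.
by rewrite sqr_sqrtr// mulr_ge0 ?pi_ge0//; case: ifP => _; rewrite ?mulr_ge0 ?expR_ge0.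
Qed.

Lemma coord_scale_gt0 D s : 0 < coord_scale D s.
Proof.
by rewrite sqrtr_gt0 mulr_gt0 ?pi_gt0//; case: ifP => _; rewrite ?mulr_gt0 ?expR_gt0.
Qed.

Lemma sqn_coords D f : sqn (coords D f) = pi * normsq D f.
Proof.
have absvE (s : S) : absv s f ^+ 2 =
    complex.Re (infp_emb s f) ^+ 2 + complex.Im (infp_emb s f) ^+ 2.
  by rewrite /absv; case: (infp_emb s f) => x y /=; rewrite sqr_sqrtr// addr_ge0 ?sqr_ge0.
rewrite /sqn big_pair_bool/=.
under eq_bigr => s _ do
  rewrite !ffunE /= !exprMn coord_scale_sqr -mulrDr addrC -absvE.
rewrite (bigID (@is_real _ _ S))/= /normsq mulrDr !mulr_sumr; congr (_ + _).
  by apply: eq_bigr => s ->; ring.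
by apply: eq_bigr => s /negPf ->; ring.
Qed.

Lemma coordsB D f g : coords D (f - g) = coords D f - coords D g.
Proof.
apply/ffunP => -[s b]; rewrite !ffunE/= rmorphB.
by case: (infp_emb s f) (infp_emb s g) => [x y] [x' y']; case: b; rewrite /= -mulrBr.
Qed.

(** One infinite prime suffices, since an embedding of a field is injective. *)
Lemma coords_inj D (s : S) : injective (coords D).
Proof.
move=> f g /eqP; rewrite -subr_eq0 -coordsB => /eqP /ffunP fg.
apply/eqP; rewrite -subr_eq0 -(fmorph_eq0 (infp_emb s)) eq_complex.
have z b : (if b then complex.Im (infp_emb s (f - g))
                 else complex.Re (infp_emb s (f - g))) = 0.
  have := fg (s, b); rewrite !ffunE /= => /eqP.
  by rewrite mulf_eq0 gt_eqF ?coord_scale_gt0//= => /eqP.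
by rewrite (z false) (z true) eqxx.
Qed.

Lemma theta_coords D (s : S) :
  theta 1 (coords D @` assoc_ideal D) 0 = theta_series D.
Proof.
rewrite /theta esum_image; last by move=> f g _ _; exact: (coords_inj s).
by apply: eq_esum => f _; rewrite addr0 mul1r sqn_coords mulNr.
Qed.

Lemma theta_series_shift (D D' : arakelov_divisor S) (e : S -> R) (s0 : S) :
    (forall s, 0 <= e s) -> fin_coef D' = fin_coef D ->
    (forall s, inf_coef D' s = inf_coef D s - e s) ->
  ((expR (- \sum_s e s))%:E * theta_series D <= theta_series D')%E.
Proof.
move=> e0 eqf eqi.
have eqI : assoc_ideal D' = assoc_ideal D by rewrite /assoc_ideal eqf.
(* The ratio of the scales of [D] and [D']. A complex prime spreads [exp (- e)] over two
   coordinates; a real one puts it on the real coordinate and 1 on the vanishing imaginary one. *)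
pose r (i : S * bool) : R :=
  if is_real i.1 then (if i.2 then 1 else expR (- e i.1)) else expR (- (e i.1 / 2)).
have r01 i : 0 < r i <= 1.
  rewrite /r; case: ifP => _; [case: ifP => _|]; rewrite ?ltr01 ?lexx// expR_gt0/=.
    by rewrite -expR0 ler_expR oppr_le0.
  by rewrite -expR0 ler_expR oppr_le0 divr_ge0.
have prodE : \prod_i r i = expR (- \sum_s e s).
  rewrite big_pair_bool/= -sumrN expR_sum; apply: eq_bigr => s _.
  rewrite /r/=; case: ifP => _; first by rewrite mul1r.
  by rewrite -expRD; congr expR; field.
have sgL : subgroup (coords D' @` assoc_ideal D').
  have sgI := assoc_ideal_subgroup D'.
  split=> [|_ _ [f If <-] [g Ig <-]].
    exists 0; first exact: subgroup0.
    by rewrite -[X in coords _ X](subrr 0) coordsB subrr.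
  by exists (f - g); [exact: subgroupB|rewrite coordsB].
have := theta_stretch sgL r01; rewrite prodE (theta_coords _ s0).
rewrite esum_image; last by move=> f g _ _; exact: (coords_inj s0).
rewrite eqI; congr (_ * _ <= _)%E; apply: eq_esum => f _.
rewrite mulNr -sqn_coords; congr (expR (- _))%:E; apply: eq_bigr => -[s b] _.
rewrite !ffunE /= !exprMn !coord_scale_sqr eqi /r/=.
have [rs|_] := boolP (is_real s).
  case: b; first by move/asboolP: rs => ->; rewrite expr0n/= !mulr0.
  rewrite -expRM_natl mulrA (mulrCA (expR _)) -expRD; congr (_ * expR _ * _); ring.
rewrite -expRM_natl mulrA (mulrCA (expR _)) (mulrCA (expR _)) -expRD.
by congr (_ * (_ * expR _) * _); field.
Qed.

Lemma theta_series_le (D D' : arakelov_divisor S) :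
    fin_coef D' = fin_coef D -> (forall s, inf_coef D' s <= inf_coef D s) ->
  (theta_series D' <= theta_series D)%E.
Proof.
move=> eqf lei; rewrite /theta_series /assoc_ideal eqf.
apply: le_esum => f _; rewrite lee_fin ler_expR !mulNr lerN2 ler_wpM2l ?pi_ge0//.
apply: lerD; apply: ler_sum => s _.
  by rewrite ler_wpM2l ?sqr_ge0// ler_expR !mulNr lerN2 ler_wpM2l.
rewrite ler_wpM2l ?ler_expR ?lerN2//.
exact: mulr_ge0 (ler0n _ 2) (sqr_ge0 _).
Qed.

End Divisors.

Theorem proposition3 (R : realType) (F : fieldExtType rat)
    (S : infinite_primes R F) :
  h0_max_at_origin S ->
  forall D : arakelov_divisor S,
    0 <= deg D -> h0 D <= deg D + h0 (trivial_divisor S).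
Proof.
move=> h0max D d0; have O0 := h0_ge0 (trivial_divisor S).
(* Without an infinite prime there is no coefficient to absorb the degree. *)
have [s0 _|S0] := pickP (fun _ : S => true); last first.
  have D0 : h0 D <= 0 by apply: h0_le0_empty => s; have := S0 s.
  by rewrite (le_trans D0)// addr_ge0.
have [D_infinite|] := eqVneq (theta_series D) +oo%E.
  by rewrite h0_infinite// addr_ge0.
rewrite -ltey => D_finite.
pose e (s : S) : R := if s == s0 then deg D else 0.
have e0 s : 0 <= e s by rewrite /e; case: ifP.
have sum_e : \sum_s e s = deg D by rewrite -big_mkcond big_pred1_eq.
pose D' := @ArakelovDivisor R F S (fin_coef D) [ffun s => inf_coef D s - e s].
have D'E s : inf_coef D' s = inf_coef D s - e s by rewrite ffunE.
have degD' : deg D' = 0.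
  rewrite {1}/deg/=; under [X in _ + X]eq_bigr do rewrite ffunE.
  by rewrite sumrB sum_e addrA subrr.
(* Finiteness ensures that [h0 D'] is a genuine logarithm; lowering infinite coefficients only
   shrinks the series. *)
have D'_finite : (theta_series D' < +oo)%E.
  apply: le_lt_trans D_finite; apply: theta_series_le => // s.
  by rewrite D'E gerBl.
have h0D' : h0 D' <= h0 (trivial_divisor S).
  apply: (h0max (pic_class D')); last exact: pic_class_refl.
  by split; [exists D'|exists D' => //; exact: pic_class_refl].
have := theta_series_shift s0 e0 (erefl : fin_coef D' = fin_coef D) D'E.
suff step : ((expR (- \sum_s e s))%:E * theta_series D <= theta_series D')%E ->
    h0 D <= deg D + h0 D' by move=> /step /le_trans; apply; rewrite lerD2l.
move: (theta_series_ge1 D) (theta_series_ge1 D') D_finite D'_finite.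
rewrite !h0E; case: (theta_series D) => [t||//]//; case: (theta_series D') => [t'||//]//.
rewrite !lee_fin sum_e /= => t1 t1' _ _.
have t0 : 0 < t by exact: lt_le_trans t1.
have t0' : 0 < t' by exact: lt_le_trans t1'.
move=> le_t; have : ln (expR (- deg D) * t) <= ln t'.
  by rewrite ler_ln ?posrE ?mulr_gt0 ?expR_gt0.
by rewrite lnM ?posrE ?expR_gt0// expRK addrC lerBlDl.
Qed.
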